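(* Let $\{F_t\}_{t\ge0}$ be the semigroup generated by $f\in\mathcal G^+[1]$, and let $\{f_n\}\subset\mathcal G$ be a sequence of generators converging to $f$ uniformly on compact subsets of $\Delta$ such that $f_n(\tau_n)=0$ with $\tau_n\in\Delta$. Assume also that the closure of the set $\{\mu_n=f_n'(\tau_n)\}$ does not contain the origin. Then the sequence of semigroups $\{F_t^{(n)}\}_{t\ge0}$ generated by $f_n$ is such that $F_t^{(n)}(z)$ converges to $F_t(z)$ uniformly on compact subsets of $\Delta\times\mathbb R^+$.
   Context: $\Delta=\{z\in\mathbb C:|z|<1\}$, $\mathbb R^+=[0,\infty)$; $\angle\lim$ denotes the angular (non-tangential) limit. A one-parameter continuous semigroup is a family $\{F_t\}_{t\ge0}$ of holomorphic self-mappings of $\Delta$ with $F_{t+s}=F_t\circ F_s$ for $t,s\ge0$, $F_0=\mathrm{id}$, and $\lim_{t\to s}F_t(z)=F_s(z)$ for all $z\in\Delta$, $s\ge0$. Its generator is $f(z)=\lim_{t\to0^+}\frac{z-F_t(z)}{t}$ (which exists and is holomorphic on $\Delta$); the semigroup generated by $f$ is the unique solution of $\frac{\partial F_t(z)}{\partial t}+f(F_t(z))=0$, $F_0(z)=z$. $\mathcal G$ is the set of all such generators. $\mathcal G^+[1]$ is the set of $f\in\mathcal G$ with $\angle\lim_{z\to1}f(z)=0$ and $f'(1):=\angle\lim_{z\to1}\frac{f(z)}{z-1}>0$ (finite). *)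

(* Defs.v *)
From Stdlib Require Import Reals List.
From Coquelicot Require Import Coquelicot.

Open Scope R_scope.

Definition Disk (z : C) : Prop := Cmod z < 1.

Definition holomorphic_on_disk (f : C -> C) : Prop :=
  forall z : C, Disk z -> ex_derive (K := C_AbsRing) (V := C_NormedModule) f z.

Definition compact_set {T : UniformSpace} (K : T -> Prop) : Prop :=
  forall (I : Type) (U : I -> T -> Prop),
    (forall i : I, open (U i)) ->
    (forall x : T, K x -> exists i : I, U i x) ->
    exists l : list I, forall x : T, K x -> exists i : I, In i l /\ U i x.

Definition closure_of {T : UniformSpace} (A : T -> Prop) (x : T) : Prop :=
  forall P : T -> Prop, locally x P -> exists y : T, P y /\ A y.

(* All maps are total functions on C and R; only their values at points of the
   disk and at times [t >= 0] are constrained or used. *)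
Record is_semigroup (F : R -> C -> C) : Prop := {
  semigroup_holo : forall t : R, 0 <= t -> holomorphic_on_disk (F t);
  semigroup_self : forall (t : R) (z : C), 0 <= t -> Disk z -> Disk (F t z);
  semigroup_add : forall (t s : R) (z : C),
    0 <= t -> 0 <= s -> Disk z -> F (t + s) z = F t (F s z);
  semigroup_id : forall z : C, Disk z -> F 0 z = z;
  semigroup_cont : forall (s : R) (z : C), 0 <= s -> Disk z ->
    filterlim (fun t : R => F t z)
      (within (fun t : R => 0 <= t) (locally s)) (locally (F s z))
}.

(* The limit defining the generator of a semigroup is automatically holomorphic
   (Berkson and Porta); holomorphy is kept as part of the notion, so that [f] is
   understood as an element of Hol(disk, C). *)
Definition is_generator_of (f : C -> C) (F : R -> C -> C) : Prop :=
  holomorphic_on_disk f /\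
  forall z : C, Disk z ->
    filterlim (fun t : R => ((z - F t z) / RtoC t)%C) (at_right 0)
      (locally (f z)).

Definition generators (f : C -> C) : Prop :=
  exists F : R -> C -> C, is_semigroup F /\ is_generator_of f F.

(* The derivative in [t] is relative to [0, +oo): two-sided for [t > 0],
   one-sided at [t = 0]. With the filter [locally t] instead of [within ...],
   the [filterdiff] below is [is_derive (fun s => F s z) t (- f (F t z))]. *)
Definition solves_cauchy_problem (f : C -> C) (F : R -> C -> C) : Prop :=
  forall z : C, Disk z ->
    F 0 z = z /\
    forall t : R, 0 <= t ->
      filterdiff (K := R_AbsRing) (V := C_R_NormedModule)
        (fun s : R => F s z)
        (within (fun s : R => 0 <= s) (locally t))
        (fun h : R => scal h (- f (F t z))%C).

Definition semigroup_generated_by (f : C -> C) (F : R -> C -> C) : Prop :=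
  is_semigroup F /\ solves_cauchy_problem f F.

(* Non-tangential approach region (Stolz region) at the boundary point [zeta]. *)
Definition stolz (zeta : C) (k : R) (z : C) : Prop :=
  Disk z /\ Cmod (z - zeta) < k * (1 - Cmod z).

Definition angular_lim (g : C -> C) (zeta l : C) : Prop :=
  forall k : R, 1 < k ->
    filterlim g (within (stolz zeta k) (locally zeta)) (locally l).

Definition generators_plus_1 (f : C -> C) : Prop :=
  generators f /\
  angular_lim f (RtoC 1) (RtoC 0) /\
  exists a : R, 0 < a /\
    angular_lim (fun z : C => (f z / (z - RtoC 1))%C) (RtoC 1) (RtoC a).

Definition cvg_unif_on_compacts_disk (fn : nat -> C -> C) (f : C -> C) : Prop :=
  forall K : C -> Prop,
    compact_set K -> (forall z : C, K z -> Disk z) ->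
    forall eps : R, 0 < eps ->
      exists N : nat, forall n : nat, (N <= n)%nat ->
        forall z : C, K z -> Cmod (fn n z - f z) < eps.

Definition cvg_unif_on_compacts_disk_time
    (Fn : nat -> R -> C -> C) (F : R -> C -> C) : Prop :=
  forall K : C * R -> Prop,
    compact_set K -> (forall p : C * R, K p -> Disk (fst p) /\ 0 <= snd p) ->
    forall eps : R, 0 < eps ->
      exists N : nat, forall n : nat, (N <= n)%nat ->
        forall (z : C) (t : R), K (z, t) -> Cmod (Fn n t z - F t z) < eps.

(* Main.v *)
Require Import Defs.
From Stdlib Require Import Reals Lra Lia Psatz List Classical IndefiniteDescription.
From Coquelicot Require Import Coquelicot.
Open Scope R_scope.

(** The statement is continuous dependence of an ordinary differential equation
    on its right-hand side and on its initial value. Fix a point [(z0, t0)] of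
    the compact set. The trajectory [t |-> F t z0] on [[0, t0 + 1]] is continuous
    with values in the open disk, so it stays in a closed disk of some radius
    [r < 1]. On the larger disk of radius [r' = (1 + r) / 2] the field [f] is
    Lipschitz and [fn] is uniformly close to [f]. Gronwall's inequality, applied
    to the squared distance between a trajectory of [fn n] from [z] and the one
    of [f] from [z0], keeps this distance small as long as the first trajectory
    has not left the disk of radius [r'], and the bound itself prevents it from
    leaving ([trajectory_stability], [flow_stability]). Using this once for
    [fn n] and once for [f] gives the estimate for all [z] near [z0] and all
    [t < t0 + 1]; compactness makes the rank [N] uniform.

    The analytic input is that a function which is complex differentiable at
    each point of the disk, with no continuity assumed of its derivative, is
    Lipschitz on smaller disks. A bound [|f'(a)| <= 2 M / r] suffices
    ([cauchy_estimate]), and it follows from Goursat's theorem for rectangles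
    ([goursat]). The function
    [G w = (f (a + e^w) - f a) e^(-w)] is holomorphic on the half-plane
    [Re w <= ln r] and has period [2 i pi], so the integral of [G] over the
    vertical segment from [s] to [s + 2 i pi] does not depend on [s]. It tends to
    [2 i pi f'(a)] as [s] tends to [-oo], and at [s = ln r] it is bounded by
    [2 pi (2 M / r)]. *)

(** * Moduli and complex derivatives *)

Lemma Cmod_le_sum (z : C) : Cmod z <= Rabs (Re z) + Rabs (Im z).
Proof.
replace z with (RtoC (Re z) + Ci * RtoC (Im z))%C at 1.
- eapply Rle_trans; [apply Cmod_triangle|].
  rewrite Cmod_mult, Cmod_Ci, !Cmod_R; lra.
- destruct z; unfold Cplus, Cmult, Ci, RtoC; cbn; f_equal; ring.
Qed.

Lemma im_le_Cmod (z : C) : Rabs (Im z) <= Cmod z.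
Proof. eapply Rle_trans; [apply Rmax_r|apply Rmax_Cmod]. Qed.

Lemma Cmod_diag (z : C) : Cmod (z - z) = 0.
Proof. replace (z - z)%C with (RtoC 0) by ring. apply Cmod_0. Qed.

Lemma Cmod_minus_triangle (x y z : C) : Cmod (x - z) <= Cmod (x - y) + Cmod (y - z).
Proof. replace (x - z)%C with ((x - y) + (y - z))%C by ring. apply Cmod_triangle. Qed.

Lemma Cmod_le_minus (x y : C) : Cmod x <= Cmod (x - y) + Cmod y.
Proof. replace x with ((x - y) + y)%C at 1 by ring. apply Cmod_triangle. Qed.

Lemma Cmod_minus_sym (x y : C) : Cmod (x - y) = Cmod (y - x).
Proof. rewrite <- Cmod_opp. f_equal. ring. Qed.

Notation C_derivable f z := (ex_derive (K := C_AbsRing) (V := C_NormedModule) f z).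
Notation is_C_derive f z l := (is_derive (K := C_AbsRing) (V := C_NormedModule) f z l).

Lemma is_C_derive_eps (f : C -> C) (z l : C) :
  is_C_derive f z l <->
  (forall eps : R, 0 < eps -> exists delta : R, 0 < delta /\
     forall w : C, Cmod (w - z) < delta ->
       Cmod (f w - f z - (w - z) * l) <= eps * Cmod (w - z)).
Proof.
split.
- intros [_ H] eps Heps.
  destruct (H z (fun P HP => HP) (mkposreal eps Heps)) as [d Hd].
  exists d; split; [apply cond_pos|].
  intros w Hw; exact (Hd w Hw).
- intros H; split.
  + apply (is_linear_scal_l (K:=C_AbsRing) (V:=C_NormedModule)).
  + intros x Hx.
    rewrite <- (is_filter_lim_locally_unique _ _ Hx). clear x Hx.
    intros eps.
    destruct (H eps (cond_pos eps)) as [d [Hd H']].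
    exists (mkposreal d Hd). intros w Hw; exact (H' w Hw).
Qed.

(** [C] carries two norm structures over itself, with the same norm and
    different uniform structures. The product and chain rules are stated for
    the one derived from the absolute value. *)
Lemma is_C_derive_AbsRing (f : C -> C) (z l : C) :
  is_C_derive f z l <->
  is_derive (K := C_AbsRing) (V := AbsRing_NormedModule C_AbsRing) f z l.
Proof.
split; intros [_ H]; split; try exact H.
- apply (is_linear_scal_l (K := C_AbsRing) (V := AbsRing_NormedModule C_AbsRing)).
- apply (is_linear_scal_l (K := C_AbsRing) (V := C_NormedModule)).
Qed.

Lemma is_C_derive_mult (f g : C -> C) (z a b : C) :
  is_C_derive f z a -> is_C_derive g z b ->
  is_C_derive (fun w => f w * g w)%C z (a * g z + f z * b)%C.
Proof.
intros Hf%is_C_derive_AbsRing Hg%is_C_derive_AbsRing.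
apply is_C_derive_AbsRing.
exact (is_derive_mult (K := C_AbsRing) f g z a b Hf Hg Cmult_comm).
Qed.

Definition cexp (z : C) : C := (exp (Re z) * cos (Im z), exp (Re z) * sin (Im z)).

Lemma cexp_plus (z w : C) : cexp (z + w) = (cexp z * cexp w)%C.
Proof.
destruct z as [a b], w as [c d]; unfold cexp, Cmult, Cplus; cbn.
rewrite exp_plus, cos_plus, sin_plus; f_equal; ring.
Qed.

Lemma Cmod_cexp (z : C) : Cmod (cexp z) = exp (Re z).
Proof.
unfold cexp, Cmod; cbn [fst snd].
replace ((exp (Re z) * cos (Im z)) ^ 2 + (exp (Re z) * sin (Im z)) ^ 2)
  with ((exp (Re z)) ^ 2 * (Rsqr (sin (Im z)) + Rsqr (cos (Im z)))) by (unfold Rsqr; ring).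
rewrite sin2_cos2, Rmult_1_r. apply sqrt_pow2. left; apply exp_pos.
Qed.

Lemma real_derive_eps (f : R -> R) (l x : R) : is_derive f x l ->
  forall eps : R, 0 < eps -> exists delta : R, 0 < delta /\
    forall y : R, Rabs (y - x) < delta ->
      Rabs (f y - f x - (y - x) * l) <= eps * Rabs (y - x).
Proof.
intros [_ H] eps Heps.
destruct (H x (fun P HP => HP) (mkposreal eps Heps)) as [d Hd].
exists d; split; [apply cond_pos|].
intros w Hw; exact (Hd w Hw).
Qed.

(** The addition formula reduces the derivative at [z] to the one at 0, where it
    is read off from the real derivatives of [exp], [cos] and [sin] at 0. *)
Lemma is_C_derive_cexp (z : C) : is_C_derive cexp z (cexp z).
Proof.
assert (H0 : is_C_derive cexp (RtoC 0) (RtoC 1)).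
{ apply is_C_derive_eps; intros eps Heps.
  set (e := Rmin (eps / 8) (1 / 2)).
  assert (He : 0 < e) by (apply Rmin_glb_lt; lra).
  assert (He1 : e <= eps / 8) by apply Rmin_l.
  assert (He2 : e <= 1/2) by apply Rmin_r.
  destruct (real_derive_eps exp 1 0) with (eps := e) as [d1 [Hd1 H1]]; [| auto |].
  { auto_derive; auto. rewrite exp_0; ring. }
  destruct (real_derive_eps cos 0 0) with (eps := e) as [d2 [Hd2 H2]]; [| auto |].
  { auto_derive; auto. rewrite sin_0; ring. }
  destruct (real_derive_eps sin 1 0) with (eps := e) as [d3 [Hd3 H3]]; [| auto |].
  { auto_derive; auto. rewrite cos_0; ring. }
  exists (Rmin (Rmin d1 e) (Rmin d2 d3)); split.
  { apply Rmin_glb_lt; apply Rmin_glb_lt; assumption. }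
  intros w Hw. destruct w as [x y].
  replace ((x, y) - RtoC 0)%C with (x, y) in * by (unfold Cminus, Cplus, Copp, RtoC; cbn; f_equal; ring).
  assert (Hx := re_le_Cmod (x, y)); assert (Hy := im_le_Cmod (x, y)); cbn in Hx, Hy.
  assert (A1 := Rmin_l (Rmin d1 e) (Rmin d2 d3)).
  assert (A2 := Rmin_r (Rmin d1 e) (Rmin d2 d3)).
  assert (A3 := Rmin_l d1 e). assert (A4 := Rmin_r d1 e).
  assert (A5 := Rmin_l d2 d3). assert (A6 := Rmin_r d2 d3).
  specialize (H1 x); specialize (H2 y); specialize (H3 y).
  rewrite ?Rminus_0_r, ?exp_0, ?cos_0, ?sin_0 in *.
  specialize (H1 ltac:(lra)); specialize (H2 ltac:(lra)); specialize (H3 ltac:(lra)).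
  set (m := Cmod (x, y)) in *.
  eapply Rle_trans; [apply Cmod_le_sum|].
  unfold cexp, Cminus, Cplus, Copp, Cmult, RtoC; cbn.
  rewrite exp_0, cos_0, sin_0.
  assert (B0 : Rabs (exp x - 1) <= 2 * Rabs x).
  { replace (exp x - 1) with ((exp x - 1 - x * 1) + x) by ring.
    eapply Rle_trans; [apply Rabs_triang|].
    assert (B := Rabs_pos x). nra. }
  assert (Bx := Rabs_pos x). assert (By := Rabs_pos y).
  assert (B1 : Rabs (exp x) <= 2).
  { replace (exp x) with ((exp x - 1) + 1) by ring.
    eapply Rle_trans; [apply Rabs_triang|]. rewrite Rabs_R1. lra. }
  match goal with |- Rabs ?a + Rabs ?b <= _ =>
    replace a with (exp x * (cos y - 1 - y * 0) + (exp x - 1 - x * 1)) by ring;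
    replace b with (exp x * (sin y - 0 - y * 1) + (exp x - 1) * y) by ring end.
  eapply Rle_trans; [apply Rplus_le_compat; apply Rabs_triang|].
  rewrite !Rabs_mult.
  assert (Bc := Rabs_pos (cos y - 1 - y * 0)). assert (Bs := Rabs_pos (sin y - 0 - y * 1)).
  assert (Rabs (exp x) * Rabs (cos y - 1 - y * 0) <= 2 * (e * m)).
  { apply Rmult_le_compat; auto using Rabs_pos. nra. }
  assert (Rabs (exp x) * Rabs (sin y - 0 - y * 1) <= 2 * (e * m)).
  { apply Rmult_le_compat; auto using Rabs_pos. nra. }
  assert (Rabs (exp x - 1) * Rabs y <= 2 * e * m).
  { apply Rmult_le_compat; auto using Rabs_pos. lra. }
  assert (e * Rabs x <= e * m) by nra.
  assert (0 <= m) by apply Cmod_ge_0.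
  assert (0 <= eps * m) by nra.
  assert (e * m <= eps / 8 * m) by nra.
  lra. }
apply is_C_derive_eps; intros eps Heps.
destruct (proj1 (is_C_derive_eps _ _ _) H0 (eps / exp (Re z))) as [d [Hd H]].
{ apply Rdiv_lt_0_compat; auto; apply exp_pos. }
exists d; split; auto. intros w Hw.
specialize (H (w - z)%C).
replace (w - z - RtoC 0)%C with (w - z)%C in H by ring.
specialize (H Hw).
replace (cexp w) with (cexp z * cexp (w - z))%C
  by (rewrite <- cexp_plus; f_equal; ring).
replace (cexp z * cexp (w - z) - cexp z - (w - z) * cexp z)%C
  with (cexp z * (cexp (w - z) - cexp (RtoC 0) - (w - z) * RtoC 1))%C.
- rewrite Cmod_mult, Cmod_cexp.
  assert (P := exp_pos (Re z)).
  replace (eps * Cmod (w - z)) with (exp (Re z) * (eps / exp (Re z) * Cmod (w - z))) by (field; lra).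
  apply Rmult_le_compat_l; lra.
- replace (cexp (RtoC 0)) with (RtoC 1); [ring|].
  unfold cexp; cbn. rewrite exp_0, cos_0, sin_0; unfold RtoC; f_equal; ring.
Qed.

Lemma C_derivable_continuous (f : C -> C) (z : C) :
  C_derivable f z -> continuous (T := C_UniformSpace) (U := C_UniformSpace) f z.
Proof.
intros H%ex_derive_continuous P HP. apply locally_C. exact (H P HP).
Qed.

(** * Goursat's theorem for rectangles *)

(** The contour integral over a horizontal segment at height [y]; [vint] is the
    one over a vertical segment, where [dz = i dy]. With the factor [i] inside
    the integral, the same estimates apply to both kinds of sides. *)
Definition hint (g : C -> C) (y a b : R) : C :=
  RInt (V := C_R_CompleteNormedModule) (fun x => g (x, y)) a b.
Definition vint (g : C -> C) (x c d : R) : C :=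
  RInt (V := C_R_CompleteNormedModule) (fun y => Ci * g (x, y))%C c d.

Definition rectangle : Type := ((R * R) * (R * R))%type.
Definition in_rect (Q : rectangle) (z : C) : Prop :=
  let '((a, b), (c, d)) := Q in a <= Re z <= b /\ c <= Im z <= d.
Definition boundary_int (g : C -> C) (Q : rectangle) : C :=
  let '((a, b), (c, d)) := Q in
  (hint g c a b + vint g b c d - hint g d a b - vint g a c d)%C.

Lemma is_linear_Cmult (c : C) :
  is_linear (K := R_AbsRing) (U := C_R_NormedModule) (V := C_R_NormedModule)
    (fun z : C => c * z)%C.
Proof.
split.
- intros x y. exact (Cmult_plus_distr_l c x y).
- intros k [x1 x2]. destruct c as [c1 c2].
  unfold scal, Cmult; cbn. unfold prod_scal, scal, mult; cbn. unfold mult; cbn. f_equal; ring.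
- exists (Cmod c + 1); split.
  + assert (H := Cmod_ge_0 c); lra.
  + intros x. rewrite <- !Cmod_norm, Cmod_mult.
    assert (H := Cmod_ge_0 x). assert (H' := Cmod_ge_0 c). nra.
Qed.

Lemma ex_RInt_horizontal (g : C -> C) (y a b : R) : a <= b ->
  (forall x : R, a <= x <= b -> C_derivable g (x, y)) ->
  ex_RInt (V := C_R_CompleteNormedModule) (fun x => g (x, y)) a b.
Proof.
intros Hab H. apply (ex_RInt_continuous (V := C_R_CompleteNormedModule)).
rewrite Rmin_left, Rmax_right by lra. intros x Hx.
apply (continuous_comp (U := R_UniformSpace) (V := C_UniformSpace) (W := C_UniformSpace)
  (fun x => (x, y)) g).
- apply (continuous_comp_2 (fun x : R => x) (fun _ : R => y) (fun x y => (x, y))).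
  + apply continuous_id.
  + apply continuous_const.
  + apply continuous_ext with (f := fun p : R * R => p); [now intros []|apply continuous_id].
- apply C_derivable_continuous, H, Hx.
Qed.

Lemma ex_RInt_vertical (g : C -> C) (x c d : R) : c <= d ->
  (forall y : R, c <= y <= d -> C_derivable g (x, y)) ->
  ex_RInt (V := C_R_CompleteNormedModule) (fun y => Ci * g (x, y))%C c d.
Proof.
intros Hcd H. apply (ex_RInt_continuous (V := C_R_CompleteNormedModule)).
rewrite Rmin_left, Rmax_right by lra. intros y Hy.
apply (continuous_comp (U := R_UniformSpace) (V := C_UniformSpace) (W := C_UniformSpace)
  (fun y => g (x, y)) (fun z => (Ci * z)%C)).
- apply (continuous_comp (U := R_UniformSpace) (V := C_UniformSpace) (W := C_UniformSpace)
    (fun y => (x, y)) g).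
  + apply (continuous_comp_2 (fun _ : R => x) (fun y : R => y) (fun x y => (x, y))).
    * apply continuous_const.
    * apply continuous_id.
    * apply continuous_ext with (f := fun p : R * R => p); [now intros []|apply continuous_id].
  + apply C_derivable_continuous, H, Hy.
- apply (filterdiff_continuous (K := R_AbsRing) (U := C_R_NormedModule) (V := C_R_NormedModule)).
  exists (fun z : C => Ci * z)%C. apply filterdiff_linear, is_linear_Cmult.
Qed.

Lemma boundary_int_split_x (g : C -> C) (a m b c d : R) :
  a <= m <= b -> c <= d ->
  (forall z : C, in_rect ((a, b), (c, d)) z -> C_derivable g z) ->
  boundary_int g ((a, b), (c, d)) =
  (boundary_int g ((a, m), (c, d)) + boundary_int g ((m, b), (c, d)))%C.
Proof.
intros Hm Hcd H. unfold boundary_int.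
assert (E : forall y, c <= y <= d -> hint g y a b = (hint g y a m + hint g y m b)%C).
{ intros y Hy. symmetry. apply (RInt_Chasles (V := C_R_CompleteNormedModule));
  apply ex_RInt_horizontal; try lra; intros x Hx; apply H; cbn; lra. }
rewrite !E by lra. ring.
Qed.

Lemma boundary_int_split_y (g : C -> C) (a b c m d : R) :
  a <= b -> c <= m <= d ->
  (forall z : C, in_rect ((a, b), (c, d)) z -> C_derivable g z) ->
  boundary_int g ((a, b), (c, d)) =
  (boundary_int g ((a, b), (c, m)) + boundary_int g ((a, b), (m, d)))%C.
Proof.
intros Hab Hm H. unfold boundary_int.
assert (E : forall x, a <= x <= b -> vint g x c d = (vint g x c m + vint g x m d)%C).
{ intros x Hx. symmetry. apply (RInt_Chasles (V := C_R_CompleteNormedModule));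
  apply ex_RInt_vertical; try lra; intros y Hy; apply H; cbn; lra. }
rewrite !E by lra. ring.
Qed.

Lemma is_RInt_affine (u v : C) (t0 a b : R) :
  is_RInt (V := C_R_NormedModule) (fun t => u + RtoC (t - t0) * v)%C a b
    (RtoC (b - a) * u + RtoC (((b - t0) ^ 2 - (a - t0) ^ 2) / 2) * v)%C.
Proof.
assert (H : forall p q : R, is_RInt (fun t : R => p + (t - t0) * q) a b
   ((b - a) * p + ((b - t0) ^ 2 - (a - t0) ^ 2) / 2 * q)).
{ intros p q.
  replace ((b - a) * p + ((b - t0) ^ 2 - (a - t0) ^ 2) / 2 * q)
    with (minus (b * p + (b - t0) ^ 2 / 2 * q) (a * p + (a - t0) ^ 2 / 2 * q))
    by (unfold minus, plus, opp; cbn; field).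
  apply (is_RInt_derive (fun t => t * p + (t - t0) ^ 2 / 2 * q)).
  - intros x _. auto_derive; auto. field.
  - intros x _. apply (ex_derive_continuous (fun t => p + (t - t0) * q)). auto_derive; auto. }
destruct u as [u1 u2], v as [v1 v2].
apply (is_RInt_fct_extend_pair (U := R_NormedModule) (V := R_NormedModule)).
- eapply is_RInt_ext; [|match goal with |- is_RInt _ _ _ ?l =>
    replace l with ((b - a) * u1 + ((b - t0) ^ 2 - (a - t0) ^ 2) / 2 * v1) by (cbn; ring) end; apply H].
  intros x _; cbn; ring.
- eapply is_RInt_ext; [|match goal with |- is_RInt _ _ _ ?l =>
    replace l with ((b - a) * u2 + ((b - t0) ^ 2 - (a - t0) ^ 2) / 2 * v2) by (cbn; ring) end; apply H].
  intros x _; cbn; ring.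
Qed.

Lemma RInt_near_affine (h : R -> C) (u v : C) (t0 a b M : R) : a <= b ->
  ex_RInt (V := C_R_CompleteNormedModule) h a b ->
  (forall t : R, a <= t <= b -> Cmod (h t - (u + RtoC (t - t0) * v)) <= M) ->
  Cmod (RInt (V := C_R_CompleteNormedModule) h a b -
        (RtoC (b - a) * u + RtoC (((b - t0) ^ 2 - (a - t0) ^ 2) / 2) * v)) <= (b - a) * M.
Proof.
intros Hab Hh HM.
rewrite Cmod_norm.
refine (norm_RInt_le_const (V := C_R_NormedModule) (fun t => h t - (u + RtoC (t - t0) * v))%C a b _ M Hab _ _).
- intros t Ht. rewrite <- Cmod_norm. now apply HM.
- apply (is_RInt_minus (V := C_R_NormedModule)).
  + apply (RInt_correct (V := C_R_CompleteNormedModule)), Hh.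
  + apply is_RInt_affine.
Qed.

(** The integral of the affine map [z |-> k + (z - p) l] around the rectangle is
    0, so only the remainder counts; it is at most [eps] times the half-perimeter
    in modulus, over a contour of twice that length. *)
Lemma boundary_int_near_affine (g : C -> C) (p k l : C) (a b c d eps : R) :
  a <= b -> c <= d -> 0 <= eps ->
  in_rect ((a, b), (c, d)) p ->
  (forall z : C, in_rect ((a, b), (c, d)) z -> C_derivable g z) ->
  (forall z : C, in_rect ((a, b), (c, d)) z ->
     Cmod (g z - k - (z - p) * l) <= eps * Cmod (z - p)) ->
  Cmod (boundary_int g ((a, b), (c, d))) <= 2 * eps * (b - a + (d - c)) ^ 2.
Proof.
intros Hab Hcd Heps Hp Hd Hg.
destruct p as [p1 p2]. cbn in Hp.
set (M := eps * (b - a + (d - c))).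
assert (HM : forall z, in_rect ((a, b), (c, d)) z ->
  Cmod (g z - k - (z - (p1, p2)) * l) <= M).
{ intros z Hz. eapply Rle_trans; [apply Hg, Hz|].
  apply Rmult_le_compat_l; auto.
  eapply Rle_trans; [apply Cmod_le_sum|].
  destruct z as [x y]; cbn in *.
  apply Rplus_le_compat; apply Rabs_le; lra. }
assert (Hh : forall y, c <= y <= d ->
  Cmod (hint g y a b - (RtoC (b - a) * (k + Ci * RtoC (y - p2) * l) +
     RtoC (((b - p1) ^ 2 - (a - p1) ^ 2) / 2) * l)) <= (b - a) * M).
{ intros y Hy. apply RInt_near_affine; auto.
  - apply ex_RInt_horizontal; auto. intros x Hx; apply Hd; cbn; lra.
  - intros x Hx. eapply Rle_trans; [|apply (HM (x, y)); cbn; lra].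
    right; f_equal. destruct k, l, (g (x, y)).
    unfold Cminus, Cplus, Cmult, Copp, Ci, RtoC; cbn; f_equal; ring. }
assert (Hv : forall x, a <= x <= b ->
  Cmod (vint g x c d - (RtoC (d - c) * (Ci * (k + RtoC (x - p1) * l)) +
     RtoC (((d - p2) ^ 2 - (c - p2) ^ 2) / 2) * (Ci * Ci * l))) <= (d - c) * M).
{ intros x Hx. apply RInt_near_affine; auto.
  - apply ex_RInt_vertical; auto. intros y Hy; apply Hd; cbn; lra.
  - intros y Hy. eapply Rle_trans; [|apply (HM (x, y)); cbn; lra].
    right. rewrite <- (Rmult_1_l (Cmod (g (x, y) - _ - _))), <- Cmod_Ci, <- Cmod_mult.
    f_equal. destruct k, l, (g (x, y)).
    unfold Cminus, Cplus, Cmult, Copp, Ci, RtoC; cbn; f_equal; ring. }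
assert (H1 := Hh c ltac:(lra)). assert (H2 := Hv b ltac:(lra)).
assert (H3 := Hh d ltac:(lra)). assert (H4 := Hv a ltac:(lra)).
unfold boundary_int.
match type of H1 with Cmod ?e <= _ => set (e1 := e) in * end.
match type of H2 with Cmod ?e <= _ => set (e2 := e) in * end.
match type of H3 with Cmod ?e <= _ => set (e3 := e) in * end.
match type of H4 with Cmod ?e <= _ => set (e4 := e) in * end.
replace (hint g c a b + vint g b c d - hint g d a b - vint g a c d)%C
  with ((e1 + e2) + (- e3 + - e4))%C.
- eapply Rle_trans; [apply Cmod_triangle|].
  eapply Rle_trans; [apply Rplus_le_compat; apply Cmod_triangle|].
  rewrite !Cmod_opp. unfold M in *. nra.
- unfold e1, e2, e3, e4.
  destruct k, l, (hint g c a b), (hint g d a b), (vint g a c d), (vint g b c d).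
  unfold Cminus, Cplus, Cmult, Copp, Ci, RtoC; cbn; f_equal; field.
Qed.

Lemma nested_intervals (a b : nat -> R) :
  (forall n, a n <= a (S n)) -> (forall n, b (S n) <= b n) -> (forall n, a n <= b n) ->
  exists l : R, forall n, a n <= l <= b n.
Proof.
intros Ha Hb Hab.
assert (Ha' : forall n k, a n <= a (n + k)%nat).
{ intros n k; induction k; [rewrite Nat.add_0_r; lra|].
  rewrite Nat.add_succ_r. specialize (Ha (n + k)%nat); lra. }
assert (Hb' : forall n k, b (n + k)%nat <= b n).
{ intros n k; induction k; [rewrite Nat.add_0_r; lra|].
  rewrite Nat.add_succ_r. specialize (Hb (n + k)%nat); lra. }
assert (H : forall n m, a n <= b m).
{ intros n m. assert (H1 := Ha' n m). assert (H2 := Hb' m n).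
  rewrite Nat.add_comm in H2. specialize (Hab (n + m)%nat). lra. }
destruct (completeness (fun x => exists n, x = a n)) as [l [Hl1 Hl2]].
- exists (b 0%nat). intros x [n ->]. apply H.
- exists (a 0%nat). now exists 0%nat.
- exists l. intros n; split.
  + apply Hl1. now exists n.
  + apply Hl2. intros x [m ->]. apply H.
Qed.

Definition quarter (g : C -> C) (Q Q' : rectangle) : Prop :=
  let '((a, b), (c, d)) := Q in
  let '((a', b'), (c', d')) := Q' in
  a <= a' /\ b' <= b /\ b' - a' = (b - a) / 2 /\
  c <= c' /\ d' <= d /\ d' - c' = (d - c) / 2 /\
  Cmod (boundary_int g Q) <= 4 * Cmod (boundary_int g Q').

Lemma exists_quarter (g : C -> C) (a b c d : R) :
  a <= b -> c <= d ->
  (forall z : C, in_rect ((a, b), (c, d)) z -> C_derivable g z) ->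
  exists Q' : rectangle, quarter g ((a, b), (c, d)) Q'.
Proof.
intros Hab Hcd Hg.
assert (Hhalf : forall u v w : C, u = (v + w)%C ->
  Cmod u <= 2 * Cmod v \/ Cmod u <= 2 * Cmod w).
{ intros u v w ->. assert (H := Cmod_triangle v w).
  destruct (Rle_dec (Cmod v) (Cmod w)); [right|left]; lra. }
assert (Hx : exists a' b', a <= a' /\ b' <= b /\ b' - a' = (b - a) / 2 /\
  Cmod (boundary_int g ((a, b), (c, d))) <= 2 * Cmod (boundary_int g ((a', b'), (c, d)))).
{ destruct (Hhalf _ _ _ (boundary_int_split_x g a ((a + b) / 2) b c d ltac:(lra) Hcd Hg));
  [exists a, ((a + b) / 2)|exists ((a + b) / 2), b]; repeat split; auto; lra. }
destruct Hx as [a' [b' [H1 [H2 [H3 H4]]]]].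
assert (Hy : exists c' d', c <= c' /\ d' <= d /\ d' - c' = (d - c) / 2 /\
  Cmod (boundary_int g ((a', b'), (c, d))) <= 2 * Cmod (boundary_int g ((a', b'), (c', d')))).
{ assert (Hg' : forall z : C, in_rect ((a', b'), (c, d)) z -> C_derivable g z).
  { intros z Hz; apply Hg; cbn in *; lra. }
  destruct (Hhalf _ _ _ (boundary_int_split_y g a' b' c ((c + d) / 2) d ltac:(lra) ltac:(lra) Hg'));
  [exists c, ((c + d) / 2)|exists ((c + d) / 2), d]; repeat split; auto; lra. }
destruct Hy as [c' [d' [H5 [H6 [H7 H8]]]]].
exists ((a', b'), (c', d')). repeat split; auto; lra.
Qed.

(** Bisection: the four boundary integrals around the quarters add up to the one
    around the whole, so one of them keeps a quarter of its modulus. Iterating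
    gives nested rectangles, which shrink to a point [p]. Near [p] the function
    is affine up to [eps * Cmod (z - p)], so the [n]-th integral is [O(eps / 4^n)],
    which matches the loss of [4^n] in the bisection. *)
Lemma goursat (g : C -> C) (a b c d : R) :
  a <= b -> c <= d ->
  (forall z : C, in_rect ((a, b), (c, d)) z -> C_derivable g z) ->
  boundary_int g ((a, b), (c, d)) = RtoC 0.
Proof.
intros Hab Hcd Hg.
set (Q0 := ((a, b), (c, d)) : rectangle).
set (inside := fun Q : rectangle => let '((a', b'), (c', d')) := Q in
  a <= a' <= b' /\ b' <= b /\ c <= c' <= d' /\ d' <= d).
assert (Hnext : forall Q, exists Q', inside Q -> inside Q' /\ quarter g Q Q').
{ intros [[a1 b1] [c1 d1]].
  (* Choice is made on all rectangles; outside the original one any value does. *)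
  destruct (classic (inside ((a1, b1), (c1, d1)))) as [Hin|Hin].
  2: exists Q0; tauto.
  destruct (exists_quarter g a1 b1 c1 d1) as [[[a2 b2] [c2 d2]] H]; cbn in *; try lra.
  - intros z Hz; apply Hg; lra.
  - exists ((a2, b2), (c2, d2)). intros _. split; [cbn in *; lra|exact H]. }
apply functional_choice in Hnext. destruct Hnext as [next Hnext].
set (Q := fun n => Nat.iter n next Q0).
assert (Hin : forall n, inside (Q n)).
{ induction n; [cbn; lra|]. now apply Hnext. }
assert (Hq : forall n, quarter g (Q n) (Q (S n))).
{ intros n. now apply Hnext. }
set (al := fun n => fst (fst (Q n))). set (be := fun n => snd (fst (Q n))).
set (ga := fun n => fst (snd (Q n))). set (de := fun n => snd (snd (Q n))).
assert (HQ : forall n, Q n = ((al n, be n), (ga n, de n))).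
{ intros n; unfold al, be, ga, de. now destruct (Q n) as [[] []]. }
assert (Hin' : forall n, a <= al n <= be n /\ be n <= b /\ c <= ga n <= de n /\ de n <= d).
{ intros n; specialize (Hin n). rewrite HQ in Hin. exact Hin. }
assert (Hq' : forall n, al n <= al (S n) /\ be (S n) <= be n /\
  be (S n) - al (S n) = (be n - al n) / 2 /\
  ga n <= ga (S n) /\ de (S n) <= de n /\ de (S n) - ga (S n) = (de n - ga n) / 2 /\
  Cmod (boundary_int g (Q n)) <= 4 * Cmod (boundary_int g (Q (S n)))).
{ intros n; specialize (Hq n). rewrite (HQ n), (HQ (S n)) in Hq |- *. exact Hq. }
clearbody al be ga de.
assert (E0 : al 0%nat = a /\ be 0%nat = b /\ ga 0%nat = c /\ de 0%nat = d).
{ assert (E := HQ 0%nat). cbn in E. now inversion E. }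
destruct E0 as [Ea [Eb [Ec Ed]]].
assert (Hsize : forall n, be n - al n + (de n - ga n) = (b - a + (d - c)) * (1 / 2) ^ n /\
  Cmod (boundary_int g Q0) <= 4 ^ n * Cmod (boundary_int g (Q n))).
{ induction n as [|n [IH1 IH2]].
  - rewrite Ea, Eb, Ec, Ed. split; [cbn; lra|]. cbn [pow]. rewrite Rmult_1_l. apply Rle_refl.
  - destruct (Hq' n) as (_ & _ & H1 & _ & _ & H2 & H3). split.
    + cbn [pow]. lra.
    + cbn [pow]. assert (0 < 4 ^ n) by (apply pow_lt; lra). nra. }
destruct (nested_intervals al be) as [p1 Hp1]; try apply Hq'; try apply Hin'.
destruct (nested_intervals ga de) as [p2 Hp2]; try apply Hq'; try apply Hin'.
assert (Hp : C_derivable g (p1, p2)).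
{ apply Hg. specialize (Hp1 0%nat). specialize (Hp2 0%nat). cbn. lra. }
destruct Hp as [l Hl]. rewrite is_C_derive_eps in Hl.
set (s := b - a + (d - c)) in *.
assert (Hs : 0 <= s) by (unfold s; lra).
assert (Hsmall : forall eps, 0 < eps -> Cmod (boundary_int g Q0) <= 2 * eps * s ^ 2).
{ intros eps Heps. destruct (Hl eps Heps) as [delta [Hdelta H]].
  destruct (pow_lt_1_zero (1 / 2)) with (y := delta / (s + 1)) as [n Hn].
  { rewrite Rabs_pos_eq; lra. }
  { apply Rdiv_lt_0_compat; lra. }
  specialize (Hn n (le_n n)).
  assert (Hpow : 0 < (1 / 2) ^ n) by (apply pow_lt; lra).
  rewrite Rabs_pos_eq in Hn by lra.
  apply (Rmult_lt_compat_l (s + 1)) in Hn; [|lra].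
  replace ((s + 1) * (delta / (s + 1))) with delta in Hn by (field; lra).
  destruct (Hsize n) as [Hw HD]. specialize (Hp1 n). specialize (Hp2 n).
  assert (Hi := Hin' n).
  eapply Rle_trans; [exact HD|].
  rewrite HQ.
  eapply Rle_trans.
  { apply Rmult_le_compat_l; [left; apply pow_lt; lra|].
    apply (boundary_int_near_affine g (p1, p2) (g (p1, p2)) l) with (eps := eps); try lra.
    - cbn; lra.
    - intros z Hz. apply Hg. cbn in *; lra.
    - intros z Hz. apply H.
      eapply Rle_lt_trans; [apply Cmod_le_sum|].
      assert (Rabs (Re (z - (p1, p2))) <= be n - al n).
      { destruct z; cbn in *. apply Rabs_le; lra. }
      assert (Rabs (Im (z - (p1, p2))) <= de n - ga n).
      { destruct z; cbn in *. apply Rabs_le; lra. }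
      lra. }
  rewrite Hw.
  replace (4 ^ n * (2 * eps * (s * (1 / 2) ^ n) ^ 2))
    with (2 * eps * s ^ 2 * (4 * (1 / 2) * (1 / 2)) ^ n) by (rewrite !Rpow_mult_distr; ring).
  replace (4 * (1 / 2) * (1 / 2)) with 1 by field. rewrite pow1. lra. }
apply Cmod_eq_0, Rle_antisym; [|apply Cmod_ge_0].
apply le_epsilon. intros eps Heps.
assert (0 < 2 * s ^ 2 + 1) by nra.
eapply Rle_trans; [apply (Hsmall (eps / (2 * s ^ 2 + 1)))|].
- apply Rdiv_lt_0_compat; auto.
- replace (2 * (eps / (2 * s ^ 2 + 1)) * s ^ 2) with (eps * ((2 * s ^ 2) / (2 * s ^ 2 + 1))) by (field; lra).
  assert (2 * s ^ 2 / (2 * s ^ 2 + 1) <= 1).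
  { apply Rle_div_l; auto; lra. }
  nra.
Qed.

(** * The Cauchy estimate *)

Lemma cexp_periodic (x : R) : cexp (x, 2 * PI) = cexp (x, 0).
Proof. unfold cexp; cbn. now rewrite cos_2PI, sin_2PI, cos_0, sin_0. Qed.

Lemma cexp_opp_periodic (x : R) : cexp (- (x, 2 * PI)) = cexp (- (x, 0)).
Proof.
unfold cexp, Copp; cbn. now rewrite !cos_neg, !sin_neg, cos_2PI, sin_2PI, cos_0, sin_0.
Qed.

Lemma cexp_mult_opp (w : C) : (cexp w * cexp (- w) = RtoC 1)%C.
Proof.
rewrite <- cexp_plus. replace (w + - w)%C with (RtoC 0) by ring.
unfold cexp; cbn. rewrite exp_0, cos_0, sin_0; unfold RtoC; f_equal; ring.
Qed.

(** In the variable [w], where [z = a + cexp w], dividing by [z - a] is multiplying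
    by [cexp (- w)]. *)
Lemma C_derivable_difference_quotient (f : C -> C) (a w : C) :
  C_derivable f (a + cexp w)%C ->
  C_derivable (fun w => (f (a + cexp w) - f a) * cexp (- w))%C w.
Proof.
intros [l Hl]. eexists. apply is_C_derive_mult.
- apply (is_derive_minus (K := C_AbsRing) (V := C_NormedModule) (fun w => f (a + cexp w)%C) (fun _ => f a)).
  + apply (is_derive_comp (K := C_AbsRing) (V := C_NormedModule) f (fun w => a + cexp w)%C w); [exact Hl|].
    apply is_C_derive_AbsRing.
    apply (is_derive_plus (K := C_AbsRing) (V := C_NormedModule) (fun _ => a) cexp).
    * apply (is_derive_const (K := C_AbsRing) (V := C_NormedModule)).
    * apply is_C_derive_cexp.
  + apply (is_derive_const (K := C_AbsRing) (V := C_NormedModule)).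
- apply (is_derive_comp (K := C_AbsRing) (V := C_NormedModule) cexp Copp).
  + apply is_C_derive_cexp.
  + apply is_C_derive_AbsRing, (is_derive_opp (K := C_AbsRing) (V := C_NormedModule) (fun w => w)).
    apply is_C_derive_AbsRing, (is_derive_id (K := C_AbsRing)).
Qed.

(** In the variable [w] with [z = a + e^w], the circles of center [a] become
    vertical segments of length [2 pi], and Goursat's theorem compares two of
    them. The center [a] corresponds to [Re w = -oo], so the derivative at [a]
    enters as the limit of the difference quotient. *)
Lemma cauchy_estimate (f : C -> C) (a l : C) (r M : R) :
  0 < r ->
  (forall z : C, Cmod (z - a) <= r -> C_derivable f z) ->
  (forall z : C, Cmod (z - a) <= r -> Cmod (f z) <= M) ->
  is_C_derive f a l ->
  Cmod l <= 2 * M / r.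
Proof.
intros Hr Hf HM Hl.
set (G := (fun w => (f (a + cexp w) - f a) * cexp (- w))%C).
assert (Hmod : forall w, Re w <= ln r -> Cmod (a + cexp w - a) <= r).
{ intros w Hw. replace (a + cexp w - a)%C with (cexp w) by ring.
  rewrite Cmod_cexp, <- (exp_ln r Hr) at 1.
  destruct Hw as [Hw|Hw]; [left; now apply exp_increasing|right; now rewrite Hw]. }
assert (HG : forall w, Re w <= ln r -> C_derivable G w).
{ intros w Hw. apply C_derivable_difference_quotient, Hf, Hmod, Hw. }
assert (Ppi := PI_RGT_0).
assert (Hex : forall s, s <= ln r ->
  ex_RInt (V := C_R_CompleteNormedModule) (fun y => Ci * G (s, y))%C 0 (2 * PI)).
{ intros s Hs. apply ex_RInt_vertical; [lra|]. intros y _; now apply HG. }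
assert (Hinv : forall s, s <= ln r -> vint G s 0 (2 * PI) = vint G (ln r) 0 (2 * PI)).
{ intros s Hs.
  assert (H := goursat G s (ln r) 0 (2 * PI) Hs ltac:(lra)).
  unfold boundary_int in H.
  (* The two horizontal sides cancel by periodicity. *)
  assert (E : hint G (2 * PI) s (ln r) = hint G 0 s (ln r)).
  { apply (RInt_ext (V := C_R_CompleteNormedModule)). intros x _. unfold G.
    now rewrite cexp_periodic, cexp_opp_periodic. }
  rewrite E in H.
  replace (vint G s 0 (2 * PI)) with (vint G s 0 (2 * PI) + RtoC 0)%C by ring.
  rewrite <- H by (intros z Hz; apply HG; cbn in *; lra). ring. }
assert (Hlarge : Cmod (vint G (ln r) 0 (2 * PI)) <= 2 * PI * (2 * M / r)).
{ rewrite Cmod_norm.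
  replace (2 * PI) with (2 * PI - 0) at 2 by ring.
  apply (norm_RInt_le_const (V := C_R_NormedModule) (fun y => Ci * G (ln r, y))%C 0 (2 * PI));
    [lra| |apply (RInt_correct (V := C_R_CompleteNormedModule)), Hex; lra].
  intros y _. rewrite <- Cmod_norm. unfold G.
  rewrite !Cmod_mult, Cmod_Ci, Cmod_cexp.
  (* On this segment [Cmod (cexp (- w)) = / r]. *)
  replace (exp (Re (- (ln r, y)))) with (/ r).
  2: { cbn. now rewrite exp_Ropp, exp_ln. }
  rewrite Rmult_1_l. apply Rmult_le_compat_r; [left; now apply Rinv_0_lt_compat|].
  eapply Rle_trans; [apply Cmod_triangle|]. rewrite Cmod_opp.
  assert (Cmod (f a) <= M).
  { apply HM. replace (a - a)%C with (RtoC 0) by ring. rewrite Cmod_0; lra. }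
  assert (Cmod (f (a + cexp (ln r, y))%C) <= M) by (apply HM, Hmod; cbn; lra).
  lra. }
assert (Hsmall : forall eps, 0 < eps ->
  Cmod (vint G (ln r) 0 (2 * PI) - RtoC (2 * PI) * (Ci * l)) <= 2 * PI * eps).
{ intros eps Heps.
  destruct (proj1 (is_C_derive_eps _ _ _) Hl eps Heps) as [delta [Hdelta H]].
  set (s := Rmin (ln r) (ln (delta / 2))).
  assert (Hs : s <= ln r) by apply Rmin_l.
  assert (Hs' : exp s < delta).
  { apply Rle_lt_trans with (delta / 2); [|lra].
    rewrite <- (exp_ln (delta / 2)) by lra.
    assert (s <= ln (delta / 2)) as [Hlt|Heq] by apply Rmin_r;
      [left; now apply exp_increasing|right; now rewrite Heq]. }
  rewrite <- (Hinv s Hs).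
  assert (A := RInt_near_affine (fun y => Ci * G (s, y))%C (Ci * l)%C (RtoC 0) 0 0 (2 * PI) eps ltac:(lra) (Hex s Hs)).
  rewrite Rminus_0_r in A.
  replace (RtoC (2 * PI) * (Ci * l))%C with
    (RtoC (2 * PI) * (Ci * l) + RtoC (((2 * PI) ^ 2 - (0 - 0) ^ 2) / 2) * RtoC 0)%C by ring.
  apply A. intros y _.
  set (w := (s, y) : C).
  replace (Ci * G w - (Ci * l + RtoC (y - 0) * RtoC 0))%C
    with (Ci * cexp (- w) * (f (a + cexp w) - f a - ((a + cexp w) - a) * l))%C.
  - rewrite !Cmod_mult, Cmod_Ci, Cmod_cexp.
    specialize (H (a + cexp w)%C).
    replace (a + cexp w - a)%C with (cexp w) in H |- * by ring.
    rewrite Cmod_cexp in H. specialize (H Hs'). cbn [Re fst snd w Copp] in H |- *.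
    assert (P := exp_pos s).
    rewrite exp_Ropp, Rmult_1_l.
    apply (Rmult_le_reg_l (exp s)); auto.
    rewrite <- Rmult_assoc, Rinv_r, Rmult_1_l by lra. lra.
  - unfold G.
    replace (Ci * l + RtoC (y - 0) * RtoC 0)%C with (Ci * l * (cexp w * cexp (- w)))%C
      by (rewrite cexp_mult_opp; ring).
    ring. }
assert (Hfin : 2 * PI * Cmod l <= 2 * PI * (2 * M / r)).
{ apply le_epsilon. intros eps Heps.
  replace (2 * PI * Cmod l) with (Cmod (RtoC (2 * PI) * (Ci * l))).
  2: { rewrite !Cmod_mult, Cmod_Ci, Cmod_R, Rabs_pos_eq; lra. }
  set (V := vint G (ln r) 0 (2 * PI)) in *. set (W := (RtoC (2 * PI) * (Ci * l))%C) in *.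
  replace W with (V + - (V - W))%C by ring.
  eapply Rle_trans; [apply Cmod_triangle|]. rewrite Cmod_opp.
  apply Rplus_le_compat; auto.
  replace eps with (2 * PI * (eps / (2 * PI))) by (field; lra).
  apply Hsmall. apply Rdiv_lt_0_compat; lra. }
apply Rmult_le_reg_l in Hfin; lra.
Qed.

(** * Compactness and Lipschitz bounds *)

(** The form in which compactness is used: a finite subcover involves finitely
    many ranks, and the largest one serves everywhere. *)
Lemma compact_eventually {T : UniformSpace} (K : T -> Prop) (P : nat -> T -> Prop) :
  compact_set K ->
  (forall x : T, K x -> exists (U : T -> Prop) (N : nat), open U /\ U x /\
     forall (n : nat) (y : T), (N <= n)%nat -> K y -> U y -> P n y) ->
  exists N : nat, forall (n : nat) (y : T), (N <= n)%nat -> K y -> P n y.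
Proof.
intros HK H.
set (good := fun V : (T -> Prop) * nat => open (fst V) /\
  forall (n : nat) (y : T), (snd V <= n)%nat -> K y -> fst V y -> P n y).
destruct (HK {V | good V} (fun V => fst (proj1_sig V))) as [l Hl].
- intros [V HV]. apply HV.
- intros x Hx. destruct (H x Hx) as [U [N [HU [Ux HN]]]].
  now exists (exist good (U, N) (conj HU HN)).
- exists (fold_right (fun (V : {V | good V}) N => max (snd (proj1_sig V)) N) 0%nat l).
  intros n y Hn Ky. destruct (Hl y Ky) as [V [HV Vy]].
  destruct V as [V [HVo HVP]]; cbn in Vy.
  apply HVP; auto. clear -Hn HV.
  induction l as [|W l IH]; [destruct HV|].
  cbn in Hn. destruct HV as [->|HV]; cbn in *; [lia|]. apply IH; auto; lia.
Qed.

Lemma open_of_Cmod (P : C -> Prop) :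
  (forall z : C, P z -> exists delta : R, 0 < delta /\
     forall w : C, Cmod (w - z) < delta -> P w) ->
  open (T := C_UniformSpace) P.
Proof.
intros H z Hz. apply locally_C. destruct (H z Hz) as [delta [Hdelta Hw]].
exists (mkposreal delta Hdelta). exact Hw.
Qed.

Lemma open_Cmod_lt (c : C) (r : R) :
  open (T := C_UniformSpace) (fun z : C => Cmod (z - c) < r).
Proof.
apply open_of_Cmod. intros z Hz. exists (r - Cmod (z - c)). split; [lra|].
intros w Hw. assert (H := Cmod_minus_triangle w z c). lra.
Qed.

Lemma open_Cmod_gt (r : R) : open (T := C_UniformSpace) (fun z : C => r < Cmod z).
Proof.
apply open_of_Cmod. intros z Hz. exists (Cmod z - r). split; [lra|].
intros w Hw. assert (H := Cmod_le_minus z w). rewrite Cmod_minus_sym in H. lra.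
Qed.

(** The square [[-rho, rho]^2] admits a finite subcover by the balls given by the
    cover near the points of the disk, and by balls that avoid the disk near the
    other points. *)
Lemma compact_closed_disk (rho : R) : compact_set (fun z : C => Cmod z <= rho).
Proof.
intros I U HU Hcov.
set (toC := fun t : Compactness.Tn 2 R => (fst t, fst (snd t)) : C).
assert (Hdelta : forall t : Compactness.Tn 2 R, exists delta : posreal,
  (exists i : I, forall z : C, ball (toC t) delta z -> U i z) \/
  (forall z : C, ball (toC t) delta z -> rho < Cmod z)).
{ intros t. destruct (Rle_dec (Cmod (toC t)) rho) as [Ht|Ht].
  - destruct (Hcov _ Ht) as [i Hi]. destruct (HU i _ Hi) as [delta Hd].
    exists delta. left. now exists i.
  - destruct (open_Cmod_gt rho (toC t)) as [delta Hd]; [lra|].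
    exists delta. now right. }
apply functional_choice in Hdelta. destruct Hdelta as [delta Hdelta].
apply NNPP. intros Hn.
apply (compactness_list 2 (- rho, (- rho, tt)) (rho, (rho, tt)) delta).
intros [l Hl]. apply Hn. clear Hn.
assert (Hlist : forall l : list (Compactness.Tn 2 R), exists l' : list I,
  forall z : C, Cmod z <= rho ->
    (exists t, In t l /\ ball (toC t) (delta t) z) -> exists i, In i l' /\ U i z).
{ clear l Hl. induction l as [|t l [l' IH]].
  - exists nil. intros z _ [t [[] _]].
  - destruct (Hdelta t) as [[i Hi]|Hout].
    + exists (i :: l'). intros z Hz [t' [[<-|Ht'] Hb]].
      * exists i. split; [now left|now apply Hi].
      * destruct (IH z Hz) as [j [Hj HUj]]; [now exists t'|].
        exists j. split; [now right|exact HUj].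
    + exists l'. intros z Hz [t' [[<-|Ht'] Hb]].
      * apply Hout in Hb. lra.
      * apply (IH z Hz). now exists t'. }
destruct (Hlist l) as [l' Hl']. exists l'.
intros z Hz. apply Hl'; auto.
destruct (Hl (fst z, (snd z, tt))) as [t [Ht [_ Hc]]].
- assert (H1 := re_le_Cmod z). assert (H2 := im_le_Cmod z). unfold Re, Im in *.
  apply Rabs_le_between in H1, H2. cbn. lra.
- exists t. split; auto. destruct t as [t1 [t2 []]]. cbn in Hc. split; apply Hc.
Qed.

(** [f] is bounded near each point by continuity; the bounds are taken among the
    natural numbers, so that local bounds become ranks in
    [compact_eventually]. *)
Lemma bounded_on_closed_disk (f : C -> C) (rho : R) : rho < 1 ->
  holomorphic_on_disk f ->
  exists M : R, forall z : C, Cmod z <= rho -> Cmod (f z) <= M.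
Proof.
intros Hrho Hf.
destruct (compact_eventually (fun z : C => Cmod z <= rho) (fun n z => Cmod (f z) <= INR n))
  as [N HN].
- apply compact_closed_disk.
- intros z Hz.
  assert (Hc : continuous (T := C_UniformSpace) (U := C_UniformSpace) f z).
  { apply C_derivable_continuous, Hf. unfold Disk; lra. }
  assert (Hloc := Hc _ (open_Cmod_lt (f z) 1 (f z) ltac:(
    cbv beta; rewrite Cmod_diag; lra))).
  destruct Hloc as [d Hd].
  destruct (INR_unbounded (Cmod (f z) + 1)) as [N HN].
  exists (fun w => Cmod (w - z) < d), N. split; [apply open_Cmod_lt|].
  split; [rewrite Cmod_diag; apply cond_pos|].
  intros n w Hn _ Hw.
  assert (Hw' : Cmod (f w - f z) < 1).
  { apply Hd. apply C_NormedModule_mixin_compat1, Hw. }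
  assert (Hn' := le_INR _ _ Hn).
  replace (f w) with ((f w - f z) + f z)%C by ring.
  eapply Rle_trans; [apply Cmod_triangle|]. lra.
- exists (INR N). intros z Hz. now apply HN.
Qed.

(** The factors [c = 1] and [c = - Ci] give the real and imaginary parts, and
    [c = Cconj u] gives [Cmod u] times the component in the direction of [u]. *)
Lemma is_derive_component (x : R -> C) (t : R) (v c : C) :
  is_derive (K := R_AbsRing) (V := C_R_NormedModule) x t v ->
  is_derive (fun s => Re (c * x s)) t (Re (c * v)).
Proof.
intros H.
apply (filterdiff_comp' (K := R_AbsRing) (U := R_NormedModule) (V := C_R_NormedModule) (W := R_NormedModule)
   x (fun z : C => Re (c * z)) t _ (fun z : C => Re (c * z))) in H.
- refine (filterdiff_ext_lin _ _ _ H _). intros y.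
  destruct v, c. unfold scal; cbn. unfold prod_scal, scal, mult; cbn. unfold mult; cbn. ring.
- apply (filterdiff_linear (K := R_AbsRing) (U := C_R_NormedModule) (V := R_NormedModule)).
  apply (is_linear_comp (K := R_AbsRing) (U := C_R_NormedModule) (V := C_R_NormedModule) (W := R_NormedModule)
    (fun z : C => (c * z)%C) (fun z : C => fst z)).
  + apply is_linear_Cmult.
  + apply (is_linear_fst (K := R_AbsRing) (U := R_NormedModule) (V := R_NormedModule)).
Qed.

Lemma is_derive_along_line (f : C -> C) (p d l : C) (t : R) :
  is_C_derive f (p + RtoC t * d)%C l ->
  is_derive (K := R_AbsRing) (V := C_R_NormedModule)
    (fun s : R => f (p + RtoC s * d)%C) t (d * l)%C.
Proof.
intros H. assert (H' := proj1 (is_C_derive_eps _ _ _) H). clear H.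
split; [apply (is_linear_scal_l (K := R_AbsRing) (V := C_R_NormedModule))|].
intros t' Ht'. rewrite <- (is_filter_lim_locally_unique _ _ Ht'). clear t' Ht'.
intros eps.
assert (Hd : 0 < Cmod d + 1) by (assert (A := Cmod_ge_0 d); lra).
destruct (H' (eps / (Cmod d + 1))) as [delta [Hdelta H]].
{ apply Rdiv_lt_0_compat; auto; apply cond_pos. }
assert (Hdelta' : 0 < delta / (Cmod d + 1)) by (now apply Rdiv_lt_0_compat).
exists (mkposreal _ Hdelta'). intros s Hs.
change (Rabs (s - t) < delta / (Cmod d + 1)) in Hs.
specialize (H (p + RtoC s * d)%C).
replace (p + RtoC s * d - (p + RtoC t * d))%C with (RtoC (s - t) * d)%C in H.
2: { rewrite RtoC_minus; ring. }
rewrite Cmod_mult, Cmod_R in H.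
assert (A := Rabs_pos (s - t)). assert (B := Cmod_ge_0 d).
apply Rlt_div_r in Hs; [|lra].
specialize (H ltac:(nra)).
rewrite <- Cmod_norm.
change (norm (minus s t)) with (Rabs (s - t)).
match goal with |- Cmod ?e <= _ =>
  replace e with (f (p + RtoC s * d) - f (p + RtoC t * d) - RtoC (s - t) * d * l)%C end.
- eapply Rle_trans; [exact H|].
  replace (eps / (Cmod d + 1) * (Rabs (s - t) * Cmod d))
    with (eps * Rabs (s - t) * (Cmod d / (Cmod d + 1))) by (field; lra).
  assert (Cmod d / (Cmod d + 1) <= 1) by (apply Rle_div_l; lra).
  assert (0 <= eps * Rabs (s - t)) by (apply Rmult_le_pos; [left; apply cond_pos|auto]).
  nra.
- destruct (f (p + RtoC s * d)%C), (f (p + RtoC t * d)%C), d, l.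
  unfold minus, plus, opp, scal; cbn.
  unfold prod_scal, prod_plus, prod_opp, minus, plus, opp, scal, mult, Cminus, Cplus, Copp, Cmult, RtoC; cbn.
  unfold plus, opp, mult; cbn.
  f_equal; ring.
Qed.

(** The Cauchy estimate on disks of radius [(1 - rho) / 2] bounds the derivative
    on the smaller disk, which is convex. As the mean value theorem fails for
    complex values, it is applied to the component of [f] in the direction of
    [u = f z - f w], whose increment is [Cmod u ^ 2]. *)
Lemma lipschitz_on_closed_disk (f : C -> C) (rho : R) : rho < 1 ->
  holomorphic_on_disk f ->
  exists L : R, 0 <= L /\
    forall z w : C, Cmod z <= rho -> Cmod w <= rho -> Cmod (f z - f w) <= L * Cmod (z - w).
Proof.
intros Hrho Hf.
set (rho' := (rho + 1) / 2).
destruct (bounded_on_closed_disk f rho') as [M HM]; [unfold rho'; lra|auto|].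
set (r := (1 - rho) / 2). assert (Hr : 0 < r) by (unfold r; lra).
set (L := Rmax 0 (2 * M / r)).
assert (HL : forall z l, Cmod z <= rho -> is_C_derive f z l -> Cmod l <= L).
{ intros z l Hz Hl. eapply Rle_trans; [|apply Rmax_r].
  apply (cauchy_estimate f z); auto.
  - intros w Hw. apply Hf. unfold Disk.
    replace w with ((w - z) + z)%C by ring.
    eapply Rle_lt_trans; [apply Cmod_triangle|]. unfold r in *; lra.
  - intros w Hw. apply HM.
    replace w with ((w - z) + z)%C by ring.
    eapply Rle_trans; [apply Cmod_triangle|]. unfold r, rho' in *; lra. }
exists L. split; [apply Rmax_l|].
intros z w Hz Hw.
set (u := (f z - f w)%C).
set (phi := fun t : R => Re (Cconj u * f (w + RtoC t * (z - w))%C)).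
assert (Hseg : forall t, 0 <= t <= 1 -> Cmod (w + RtoC t * (z - w)) <= rho).
{ intros t Ht. replace (w + RtoC t * (z - w))%C with (RtoC (1 - t) * w + RtoC t * z)%C
    by (rewrite RtoC_minus; ring).
  eapply Rle_trans; [apply Cmod_triangle|]. rewrite !Cmod_mult, !Cmod_R, !Rabs_pos_eq by lra. nra. }
assert (Hphi : forall t, 0 <= t <= 1 ->
  is_derive phi t (Re (Cconj u * ((z - w) * C_derive f (w + RtoC t * (z - w))%C)))).
{ intros t Ht. apply is_derive_component, is_derive_along_line.
  apply C_derive_correct; [exact (RtoC 0)|]. apply Hf. unfold Disk. specialize (Hseg t Ht). lra. }
destruct (MVT_gen phi 0 1 (fun t => Re (Cconj u * ((z - w) * C_derive f (w + RtoC t * (z - w))%C))))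
  as [c [Hc E]].
- intros t Ht. rewrite Rmin_left, Rmax_right in Ht by lra. apply Hphi; lra.
- intros t Ht. rewrite Rmin_left, Rmax_right in Ht by lra.
  apply continuity_pt_filterlim, (ex_derive_continuous phi). eexists; apply Hphi; lra.
- rewrite Rmin_left, Rmax_right in Hc by lra.
  assert (E1 : phi 1 - phi 0 = Cmod u ^ 2).
  { unfold phi. replace (w + RtoC 1 * (z - w))%C with z by ring.
    replace (w + RtoC 0 * (z - w))%C with w by ring.
    rewrite Cmod2_alt. unfold u. destruct (f z), (f w). cbn. ring. }
  rewrite E1, Rminus_0_r, Rmult_1_r in E.
  assert (Hle : Cmod u ^ 2 <= Cmod u * (L * Cmod (z - w))).
  { rewrite E. eapply Rle_trans; [apply Rle_abs|].
    eapply Rle_trans; [apply re_le_Cmod|]. rewrite !Cmod_mult, Cmod_conj.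
    apply Rmult_le_compat_l; [apply Cmod_ge_0|].
    rewrite (Rmult_comm L). apply Rmult_le_compat_l; [apply Cmod_ge_0|].
    apply (HL (w + RtoC c * (z - w))%C); [now apply Hseg|].
    apply C_derive_correct; [exact (RtoC 0)|]. apply Hf. unfold Disk. specialize (Hseg c Hc). lra. }
  destruct (Cmod_ge_0 u) as [Hu|Hu].
  + apply (Rmult_le_reg_l (Cmod u)); auto. nra.
  + rewrite <- Hu. apply Rmult_le_pos; [apply Rmax_l|apply Cmod_ge_0].
Qed.

(** * Trajectories and their stability *)

Lemma is_derive_Cmod_sqr (x : R -> C) (t : R) (v : C) :
  is_derive (K := R_AbsRing) (V := C_R_NormedModule) x t v ->
  is_derive (fun s => Cmod (x s) ^ 2) t (2 * Re (Cconj (x t) * v)).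
Proof.
intros H.
assert (H1 := is_derive_component x t v (RtoC 1) H).
assert (H2 := is_derive_component x t v (- Ci)%C H).
apply is_derive_ext with
  (f := fun s => Re (RtoC 1 * x s) * Re (RtoC 1 * x s) + Re (- Ci * x s) * Re (- Ci * x s)).
- intros s. rewrite Cmod2_alt. destruct (x s); cbn; ring.
- match goal with |- is_derive _ _ ?l => replace l with
    ((Re (RtoC 1 * v) * Re (RtoC 1 * x t) + Re (RtoC 1 * x t) * Re (RtoC 1 * v)) +
     (Re (- Ci * v) * Re (- Ci * x t) + Re (- Ci * x t) * Re (- Ci * v))) end.
  2: { destruct (x t), v; cbn; ring. }
  apply (is_derive_plus (K := R_AbsRing) (V := R_NormedModule));
    apply (is_derive_mult (K := R_AbsRing)); auto using Rmult_comm.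
Qed.

Lemma gronwall (v dv : R -> R) (k m t : R) :
  0 <= k -> 0 <= m -> 0 <= t ->
  (forall s, 0 <= s <= t -> continuity_pt v s) ->
  (forall s, 0 < s < t -> is_derive v s (dv s) /\ dv s <= k * v s + m) ->
  v t <= (v 0 + m * t) * exp (k * t).
Proof.
intros Hk Hm Ht Hc Hd.
set (h := fun s => v s * exp (- k * s) - m * s).
set (dh := fun s => dv s * exp (- k * s) + v s * (- k * exp (- k * s)) - m).
assert (Hdh : forall s, 0 < s < t -> is_derive h s (dh s)).
{ intros s Hs. unfold h, dh.
  apply (is_derive_minus (K := R_AbsRing) (V := R_NormedModule)
    (fun s => v s * exp (- k * s)) (fun s => m * s)).
  - apply (is_derive_mult (K := R_AbsRing) v (fun s => exp (- k * s)));
      [apply Hd; lra| |exact Rmult_comm].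
    auto_derive; auto. ring.
  - auto_derive; auto. ring. }
assert (Hneg : forall s, 0 < s < t -> dh s <= 0).
{ intros s Hs. destruct (Hd s Hs) as [_ Hle]. unfold dh.
  assert (P := exp_pos (- k * s)).
  assert (exp (- k * s) <= 1).
  { rewrite <- exp_0. destruct (Req_dec k 0) as [->|Hk0].
    - right; f_equal; ring.
    - left; apply exp_increasing. nra. }
  nra. }
(* The minimum with 0 leaves the derivative unchanged inside the interval and
   makes the sign known at the endpoints, where the intermediate point may lie. *)
destruct (MVT_gen h 0 t (fun s => Rmin (dh s) 0)) as [c [Hc' E]].
- intros s Hs. rewrite Rmin_left, Rmax_right in Hs by lra.
  rewrite Rmin_left by now apply Hneg. now apply Hdh.
- intros s Hs. rewrite Rmin_left, Rmax_right in Hs by lra.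
  apply continuity_pt_minus; [apply continuity_pt_mult|]; auto;
    apply derivable_continuous_pt; reg.
- assert (Hle : h t <= h 0).
  { assert (Rmin (dh c) 0 <= 0) by apply Rmin_r. nra. }
  unfold h in Hle. rewrite !Rmult_0_r, exp_0 in Hle.
  assert (P := exp_pos (k * t)).
  replace (v t) with (v t * exp (- k * t) * exp (k * t)).
  + apply Rmult_le_compat_r; lra.
  + rewrite Rmult_assoc, <- exp_plus. replace (- k * t + k * t) with 0 by ring.
    rewrite exp_0; ring.
Qed.

(** Continuous induction: the set of times up to which [h] has stayed below [c]
    has a supremum, which the step hypothesis includes and continuity pushes
    further. *)
Lemma first_exit (h : R -> R) (T c : R) :
  (forall t, 0 <= t <= T -> continuity_pt h t) ->
  (forall t, 0 <= t <= T -> (forall s, 0 <= s < t -> h s < c) -> h t < c) ->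
  forall t, 0 <= t <= T -> h t < c.
Proof.
intros Hc Hstep t Ht.
set (E := fun t => 0 <= t <= T /\ forall s, 0 <= s < t -> h s < c).
destruct (completeness E) as [m [Hm1 Hm2]].
- exists T. intros s [Hs _]. lra.
- exists 0. split; [lra|]. intros s Hs; lra.
- assert (Hm0 : 0 <= m) by (apply Hm1; split; [lra|]; intros s Hs; lra).
  assert (HmT : m <= T) by (apply Hm2; intros s [Hs _]; lra).
  assert (Hbelow : forall s, 0 <= s < m -> h s < c).
  { intros s Hs. apply NNPP. intros Hn.
    assert (m <= s); [|lra]. apply Hm2. intros t' [Ht' H'].
    destruct (Rle_lt_dec t' s) as [Hl|Hl]; auto. destruct Hn. apply H'; lra. }
  assert (Hhm : h m < c) by (apply Hstep; auto; lra).
  destruct (Rle_lt_dec t m) as [Htm|Htm].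
  { destruct Htm as [Htm| ->]; auto. apply Hbelow; lra. }
  destruct (Hc m ltac:(lra) (c - h m)) as [d [Hd Hdist]]; [lra|].
  set (t' := Rmin t (m + d / 2)).
  assert (Ht' : m < t') by (apply Rmin_glb_lt; lra).
  assert (t' <= t) by apply Rmin_l. assert (t' <= m + d / 2) by apply Rmin_r.
  assert (t' <= m); [|lra]. apply Hm1. split; [lra|].
  intros s Hs. destruct (Rlt_le_dec s m) as [Hsm|Hsm]; [apply Hbelow; lra|].
  destruct (Req_dec s m) as [->|Hne]; auto.
  specialize (Hdist s). unfold dist, D_x, no_cond in Hdist; cbn in Hdist.
  unfold R_dist in Hdist.
  assert (Habs : Rabs (h s - h m) < c - h m).
  { apply Hdist. split; [split; auto|]. rewrite Rabs_pos_eq; lra. }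
  apply Rabs_lt_between in Habs. lra.
Qed.

Lemma continuity_pt_Cmod_sqr (x : R -> C) (t : R) :
  continuous (T := R_UniformSpace) (U := C_UniformSpace) x t ->
  continuity_pt (fun s => Cmod (x s) ^ 2) t.
Proof.
intros H. apply continuity_pt_filterlim.
apply (continuous_ext (fun s => (fun p : R * R => fst p * fst p + snd p * snd p) (x s))).
{ intros s. rewrite Cmod2_alt. unfold Re, Im. cbn. ring. }
assert (H1 : continuous (T := R_UniformSpace) (U := R_UniformSpace) (fun s => fst (x s)) t).
{ apply (continuous_comp x fst); auto. destruct (x t); apply continuous_fst. }
assert (H2 : continuous (T := R_UniformSpace) (U := R_UniformSpace) (fun s => snd (x s)) t).
{ apply (continuous_comp x snd); auto. destruct (x t); apply continuous_snd. }
apply (continuous_plus (V := R_NormedModule) (fun s => fst (x s) * fst (x s)) (fun s => snd (x s) * snd (x s)));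
  apply (continuous_mult (K := R_AbsRing)); auto.
Qed.

(** Continuity on [[0, +oo)] and the equation on the open half-line are what the
    mean value theorem on [[0, T]] requires. *)
Definition trajectory (f : C -> C) (x : R -> C) : Prop :=
  (forall t, 0 <= t -> continuous (T := R_UniformSpace) (U := C_UniformSpace) x t) /\
  (forall t, 0 < t ->
     is_derive (K := R_AbsRing) (V := C_R_NormedModule) x t (- f (x t))%C).

(** Freezing time at 0 for negative arguments turns the one-sided notions at
    [t = 0] into two-sided continuity there. *)
Lemma trajectory_of_cauchy_problem (f : C -> C) (F : R -> C -> C) (z : C) :
  solves_cauchy_problem f F -> Disk z -> trajectory f (fun t => F (Rmax 0 t) z).
Proof.
intros HF Hz. destruct (HF z Hz) as [_ HFz]. split.
- intros t Ht. unfold continuous. rewrite Rmax_right by lra.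
  apply (filterlim_comp _ _ _ (fun t => Rmax 0 t) (fun s => F s z) _
    (within (fun s => 0 <= s) (locally t))).
  + intros P [d Hd]. exists d. intros s Hs. apply Hd; [|apply Rmax_l].
    change (Rabs (Rmax 0 s - t) < d). change (Rabs (s - t) < d) in Hs.
    unfold Rmax. destruct (Rle_dec 0 s); auto.
    apply Rabs_lt_between in Hs. apply Rabs_lt_between. lra.
  + apply (filterdiff_continuous_aux (K := R_AbsRing) (U := R_NormedModule) (V := C_R_NormedModule)
      (fun s => F s z)).
    * eexists. apply (HFz t Ht).
    * intros P HP. apply filter_le_within, HP.
- intros t Ht. rewrite Rmax_right by lra.
  destruct (HFz t ltac:(lra)) as [_ H].
  split; [apply (is_linear_scal_l (K := R_AbsRing) (V := C_R_NormedModule))|].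
  intros t' Ht'. rewrite <- (is_filter_lim_locally_unique _ _ Ht'). clear t' Ht'.
  intros eps. rewrite Rmax_right by lra.
  assert (Hpos : locally t (fun s => 0 < s)) by (apply (open_gt 0); lra).
  generalize (filter_and _ _ Hpos (H t (fun P HP => filter_le_within _ P HP) eps)).
  apply filter_imp. intros s [Hs Hle]. rewrite Rmax_right by lra. apply Hle; lra.
Qed.

(** As long as [y] stays within [eps] of [x], it stays in the disk of radius
    [r'], where [v = Cmod (y - x) ^ 2] satisfies
    [v' <= 2 sqrt v (delta + L sqrt v) <= (2 L + 1) v + delta ^ 2]. The square of
    the distance is used because it is differentiable everywhere. *)
Lemma trajectory_stability (f g : C -> C) (x y : R -> C) (T r r' L delta eta eps : R) :
  trajectory f x -> trajectory g y ->
  0 <= L -> 0 <= delta -> 0 <= eta -> 0 < eps <= r' - r ->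
  (forall z w : C, Cmod z <= r' -> Cmod w <= r' -> Cmod (f z - f w) <= L * Cmod (z - w)) ->
  (forall z : C, Cmod z <= r' -> Cmod (g z - f z) <= delta) ->
  (forall t, 0 <= t <= T -> Cmod (x t) <= r) ->
  Cmod (y 0 - x 0) <= eta ->
  (eta ^ 2 + delta ^ 2 * T) * exp ((2 * L + 1) * T) < eps ^ 2 ->
  forall t, 0 <= t <= T -> Cmod (y t - x t) < eps.
Proof.
intros [Hxc Hxd] [Hyc Hyd] HL Hdelta Heta Heps Hlip Hg Hx H0 Hbound.
set (u := fun t => (y t - x t)%C).
set (v := fun t => Cmod (u t) ^ 2).
assert (Hvc : forall t, 0 <= t -> continuity_pt v t).
{ intros t Ht. apply continuity_pt_Cmod_sqr.
  apply (continuous_minus (K := R_AbsRing) (V := C_R_NormedModule) y x); auto. }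
enough (Hv : forall t, 0 <= t <= T -> v t < eps ^ 2).
{ intros t Ht. specialize (Hv t Ht). unfold v, u in Hv.
  apply Rnot_le_lt. intros Hn. assert (eps ^ 2 <= Cmod (y t - x t) ^ 2); [|lra].
  apply pow_incr; lra. }
apply first_exit; [intros t Ht; apply Hvc; lra|].
intros t Ht Hbefore.
eapply Rle_lt_trans; [|exact Hbound].
apply Rle_trans with ((v 0 + delta ^ 2 * t) * exp ((2 * L + 1) * t)).
- apply (gronwall v (fun s => 2 * Re (Cconj (u s) * (- g (y s) + f (x s))))); try lra; try nra.
  { intros s Hs; apply Hvc; lra. }
  intros s Hs. split.
  + apply is_derive_Cmod_sqr.
    assert (D := is_derive_minus (K := R_AbsRing) (V := C_R_NormedModule) y x s _ _
      (Hyd s ltac:(lra)) (Hxd s ltac:(lra))).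
    replace (- g (y s) + f (x s))%C with (- g (y s) - - f (x s))%C by ring.
    exact D.
  + assert (Hus : Cmod (u s) < eps).
    { specialize (Hbefore s ltac:(lra)). unfold v in Hbefore.
      apply Rnot_le_lt. intros Hn. assert (eps ^ 2 <= Cmod (u s) ^ 2); [|lra].
      apply pow_incr; lra. }
    assert (Hxs : Cmod (x s) <= r) by (apply Hx; lra).
    assert (Hys : Cmod (y s) <= r').
    { assert (A := Cmod_le_minus (y s) (x s)). unfold u in Hus. lra. }
    assert (Hw : Cmod (- g (y s) + f (x s)) <= delta + L * Cmod (u s)).
    { replace (- g (y s) + f (x s))%C with (- ((g (y s) - f (y s)) + (f (y s) - f (x s))))%C by ring.
      rewrite Cmod_opp. eapply Rle_trans; [apply Cmod_triangle|].
      apply Rplus_le_compat; [now apply Hg|]. apply Hlip; auto. lra. }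
    assert (Hre : Re (Cconj (u s) * (- g (y s) + f (x s))) <= Cmod (u s) * (delta + L * Cmod (u s))).
    { eapply Rle_trans; [apply Rle_abs|]. eapply Rle_trans; [apply re_le_Cmod|].
      rewrite Cmod_mult, Cmod_conj. apply Rmult_le_compat_l; auto. apply Cmod_ge_0. }
    unfold v. assert (A := Cmod_ge_0 (u s)).
    assert (B := pow2_ge_0 (Cmod (u s) - delta)). nra.
- apply Rmult_le_compat.
  + unfold v. assert (A := pow2_ge_0 (Cmod (u 0))). assert (0 <= delta ^ 2) by apply pow2_ge_0. nra.
  + left; apply exp_pos.
  + apply Rplus_le_compat.
    * apply pow_incr. split; [apply Cmod_ge_0|exact H0].
    * apply Rmult_le_compat_l; [apply pow2_ge_0|lra].
  + destruct (Req_dec t T) as [->|Hne]; [lra|].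
    left; apply exp_increasing. nra.
Qed.

Lemma trajectory_bounded_in_disk (f : C -> C) (x : R -> C) (T : R) :
  0 <= T -> trajectory f x -> (forall t, 0 <= t -> Disk (x t)) ->
  exists r : R, r < 1 /\ forall t, 0 <= t <= T -> Cmod (x t) <= r.
Proof.
intros HT [Hc _] Hdisk.
destruct (continuity_ab_maj (fun t => Cmod (x t) ^ 2) 0 T HT) as [s [Hs Hs']].
{ intros t Ht. apply continuity_pt_Cmod_sqr, Hc; lra. }
exists (Cmod (x s)). split; [apply Hdisk; lra|].
intros t Ht. specialize (Hs t Ht).
apply Rnot_lt_le. intros Hn. assert (A := Cmod_ge_0 (x s)). nra.
Qed.

(** The same [eta] bounds the change of the field and the change of the initial
    value, and depends only on the reference trajectory. *)
Lemma flow_stability (f : C -> C) (F : R -> C -> C) (z0 : C) (T eps : R) :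
  holomorphic_on_disk f -> semigroup_generated_by f F -> Disk z0 -> 0 <= T -> 0 < eps ->
  exists r' eta : R, r' < 1 /\ 0 < eta /\
    forall (g : C -> C) (G : R -> C -> C) (z : C),
      solves_cauchy_problem g G -> Disk z -> Cmod (z - z0) < eta ->
      (forall w : C, Cmod w <= r' -> Cmod (g w - f w) <= eta) ->
      forall t, 0 <= t <= T -> Cmod (G t z - F t z0) < eps.
Proof.
intros Hf [HFs HF] Hz0 HT Heps.
set (x := fun t => F (Rmax 0 t) z0).
assert (Hx : trajectory f x) by now apply trajectory_of_cauchy_problem.
destruct (trajectory_bounded_in_disk f x T HT Hx) as [r [Hr Hxr]].
{ intros t Ht. unfold x. apply semigroup_self; auto. apply Rmax_l. }
set (r' := (1 + r) / 2).
destruct (lipschitz_on_closed_disk f r') as [L [HL Hlip]]; [unfold r'; lra|auto|].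
set (e := Rmin eps (r' - r)).
assert (He : 0 < e) by (apply Rmin_glb_lt; unfold r'; lra).
set (B := (1 + T) * exp ((2 * L + 1) * T)).
assert (HB : 0 < B) by (apply Rmult_lt_0_compat; [lra|apply exp_pos]).
(* The bound of [trajectory_stability] becomes [B * eta ^ 2]; dividing [e] by
   [B + 1] makes it smaller than [e ^ 2], without a square root. *)
exists r', (e / (B + 1)).
assert (Heta : 0 < e / (B + 1)) by (apply Rdiv_lt_0_compat; lra).
repeat split; [unfold r'; lra|exact Heta|].
intros g G z HG Hz Hzz0 Hg t Ht.
assert (H := trajectory_stability f g x (fun t => G (Rmax 0 t) z) T r r' L
  (e / (B + 1)) (e / (B + 1)) e Hx (trajectory_of_cauchy_problem g G z HG Hz)).
eapply Rlt_le_trans; [|apply (Rmin_l eps (r' - r))].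
replace (G t z) with (G (Rmax 0 t) z) by (rewrite Rmax_right by lra; reflexivity).
replace (F t z0) with (x t) by (unfold x; rewrite Rmax_right by lra; reflexivity).
apply H; auto; try lra.
- split; [exact He|apply Rmin_r].
- unfold x. rewrite Rmax_left by lra.
  destruct (HF z0 Hz0) as [-> _]. destruct (HG z Hz) as [-> _]. lra.
- replace (((e / (B + 1)) ^ 2 + (e / (B + 1)) ^ 2 * T) * exp ((2 * L + 1) * T))
    with ((e / (B + 1)) ^ 2 * B) by (unfold B; ring).
  replace (e ^ 2) with ((e / (B + 1)) ^ 2 * (B + 1) ^ 2) by (field; lra).
  apply Rmult_lt_compat_l; nra.
Qed.

Theorem theorem3p7
  (f : C -> C) (F : R -> C -> C)
  (fn : nat -> C -> C) (Fn : nat -> R -> C -> C) (tau : nat -> C)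
  (hf : generators_plus_1 f)
  (hF : semigroup_generated_by f F)
  (hfn : forall n : nat, generators (fn n))
  (hcvg : cvg_unif_on_compacts_disk fn f)
  (htau : forall n : nat, Disk (tau n))
  (hzero : forall n : nat, fn n (tau n) = RtoC 0)
  (hmu : ~ closure_of
             (fun w : C => exists n : nat, w = C_derive (fn n) (tau n))
             (RtoC 0))
  (hFn : forall n : nat, semigroup_generated_by (fn n) (Fn n)) :
  cvg_unif_on_compacts_disk_time Fn F.
Proof.
assert (Hf : holomorphic_on_disk f).
{ destruct hf as [[F' [_ [Hf _]]] _]. exact Hf. }
intros K HK Kdisk eps Heps.
destruct (compact_eventually K
  (fun n p => Cmod (Fn n (snd p) (fst p) - F (snd p) (fst p)) < eps) HK) as [N HN].
2: { exists N. intros n Hn z t HKzt. exact (HN n (z, t) Hn HKzt). }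
intros [z0 t0] HK0. destruct (Kdisk _ HK0) as [Hz0 Ht0]; cbn in Hz0, Ht0.
destruct (flow_stability f F z0 (t0 + 1) (eps / 2))
  as [r' [eta [Hr' [Heta Hstab]]]]; auto; try lra.
destruct (hcvg (fun z => Cmod z <= r')) with (eps := eta) as [N HN]; auto.
{ apply compact_closed_disk. }
{ intros z Hz. unfold Disk. lra. }
exists (fun p => Cmod (fst p - z0) < eta /\ snd p < t0 + 1), N.
split; [|split].
- apply open_and.
  + apply (open_comp (T := prod_UniformSpace C_UniformSpace R_UniformSpace) (U := C_UniformSpace)
      fst (fun z => Cmod (z - z0) < eta)); [|apply open_Cmod_lt].
    intros [z t] _. apply continuous_fst.
  + apply (open_comp (T := prod_UniformSpace C_UniformSpace R_UniformSpace) (U := R_UniformSpace)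
      snd (fun t => t < t0 + 1)); [|apply open_lt].
    intros [z t] _. apply continuous_snd.
- cbn. rewrite Cmod_diag. lra.
- intros n [z t] Hn HKz [Hz Ht]. destruct (Kdisk _ HKz) as [Hzd Ht']. cbn in *.
  assert (H1 : Cmod (Fn n t z - F t z0) < eps / 2).
  { apply (Hstab (fn n)); auto; try lra; [apply hFn|]. intros w Hw. left. now apply HN. }
  assert (H2 : Cmod (F t z - F t z0) < eps / 2).
  { apply (Hstab f); auto; try lra; [apply hF|]. intros w Hw. rewrite Cmod_diag. lra. }
  assert (H := Cmod_minus_triangle (Fn n t z) (F t z0) (F t z)).
  rewrite (Cmod_minus_sym (F t z0)) in H. lra.
Qed.
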